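(* Let $\Gamma$ be a simplicial graph with right-angled Artin group $A_\Gamma$ and Salvetti complex $S_\Gamma$. Let $Z$ be a compact connected cube complex, based at a $0$-cube $x$, with a based local isometry $Z\to S_\Gamma$. Then for every $g\in A_\Gamma-\pi_1 Z$ there is a cube complex $Y$, based at a $0$-cube $x$, denoted $(Y,x)$, such that: (1) $Z\subset Y$ (as a based subcomplex, so that the basepoint $x$ of $Y$ is the basepoint of $Z$); (2) there is a based local isometry $Y\to S_\Gamma$ such that $Z\to S_\Gamma$ factors as $Z\hookrightarrow Y\to S_\Gamma$; (3) any closed based path in $S_\Gamma$ representing $g$ lifts to a non-closed path at $x$ in $Y$; (4) $|Y^{(0)}|\leq |Z^{(0)}|\,(|g|+1)$, where $|g|$ is the word length of $g$ with respect to the standard generators of $A_\Gamma$.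
   Context: Right-angled Artin group: for a simplicial graph $\Gamma$ with vertex set $V(\Gamma)$ and edge set $E(\Gamma)$, $A_\Gamma=\langle V(\Gamma)\mid [v,w],\ \{v,w\}\in E(\Gamma)\rangle$. The standard generators are the elements of $V(\Gamma)$. Salvetti complex: $S_\Gamma$ is the nonpositively-curved cube complex with exactly one $0$-cube (its basepoint, also denoted $x$), one oriented $1$-cube labeled $v$ for each $v\in V(\Gamma)$, and, for each $n$-clique of $\Gamma$, an $n$-torus (an $n$-cube with opposite faces identified) whose $1$-cubes are those labeled by the vertices of the clique. One has $\pi_1(S_\Gamma,x)\cong A_\Gamma$, the $1$-cube labeled $v$ representing the generator $v$. Local isometry: a map $\phi:Y\to X$ of cube complexes is a local isometry if it is a locally injective combinatorial map (open cubes are sent homeomorphically to open cubes) such that, whenever $e_1,\dots,e_n$ are (ends of) $1$-cubes of $Y$ all incident to a $0$-cube $y$ and the (necessarily distinct) $1$-cubes $\phi(e_1),\dots,\phi(e_n)$ all lie in a common $n$-cube $c$ at the corner $\phi(y)$, then $e_1,\dots,e_n$ span an $n$-cube $c'$ in $Y$ with $\phi(c')=c$. (Equivalently, $\phi$ induces embeddings of vertex links onto full subcomplexes.) A local isometry to a nonpositively-curved cube complex is $\pi_1$-injective, so $\pi_1 Z=\pi_1(Z,x)$ is identified with its image in $\pi_1(S_\Gamma,x)=A_\Gamma$. $|Y^{(0)}|$ denotes the number of $0$-cubes of $Y$. Paths are combinatorial paths. *)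

(* Defs.v *)
From HB Require Import structures.
From mathcomp Require Import all_boot.
From mathcomp Require Import boolp classical_sets functions cardinality.

Set Implicit Arguments.
Unset Strict Implicit.
Unset Printing Implicit Defensive.

Import Algebra.
Local Open Scope quotient_scope.

(** * Simplicial graphs and right-angled Artin groups *)

(* The vertex set may be infinite. *)
Record sgraph := SGraph {
  vert :> choiceType;
  adj : rel vert;
  adj_sym : symmetric adj;
  adj_irr : irreflexive adj
}.

(* The letter (v, false) stands for the generator v and (v, true) for v^-1. *)
Definition letter (G : sgraph) : Type := (vert G * bool)%type.
Definition inv_letter (G : sgraph) (a : letter G) : letter G := (a.1, ~~ a.2).
Definition word (G : sgraph) : choiceType := seq (vert G * bool).

(* The congruence on words whose quotient is < V | [v, w], {v, w} in E >. *)
Inductive raag_cong (G : sgraph) : word G -> word G -> Prop :=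
| raag_refl w : raag_cong w w
| raag_sym w1 w2 : raag_cong w1 w2 -> raag_cong w2 w1
| raag_trans w1 w2 w3 : raag_cong w1 w2 -> raag_cong w2 w3 -> raag_cong w1 w3
| raag_cancel u w (a : letter G) :
    raag_cong (u ++ [:: a; inv_letter a] ++ w) (u ++ w)
| raag_comm u w (x y : vert G) : adj x y ->
    raag_cong
      (u ++ [:: (x, false); (y, false); (x, true); (y, true)] ++ w) (u ++ w).

Definition raag_eqb (G : sgraph) : rel (word G) :=
  fun w1 w2 => `[< raag_cong w1 w2 >].

Lemma raag_eqb_refl (G : sgraph) : reflexive (@raag_eqb G).
Proof. by move=> w; apply/asboolP; exact: raag_refl. Qed.

Lemma raag_eqb_sym (G : sgraph) : symmetric (@raag_eqb G).
Proof.
by move=> w1 w2; apply/asboolP/asboolP; exact: raag_sym.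
Qed.

Lemma raag_eqb_trans (G : sgraph) : transitive (@raag_eqb G).
Proof.
move=> w2 w1 w3 /asboolP h1 /asboolP h2; apply/asboolP.
exact: raag_trans h1 h2.
Qed.

Canonical raag_equiv (G : sgraph) : equiv_rel (word G) :=
  EquivRel (@raag_eqb G) (@raag_eqb_refl G) (@raag_eqb_sym G)
           (@raag_eqb_trans G).

Definition raag (G : sgraph) : Type := {eq_quot (raag_equiv G)}.
HB.instance Definition _ (G : sgraph) := Choice.on (raag G).
HB.instance Definition _ (G : sgraph) := EqQuotient.on (raag G).

Lemma raag_eqP (G : sgraph) (w1 w2 : word G) :
  \pi_(raag G) w1 = \pi_(raag G) w2 <-> raag_cong w1 w2.
Proof.
split; first by move/eqmodP/asboolP.
by move=> h; apply/eqmodP/asboolP.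
Qed.

Section RaagGroup.
Variable G : sgraph.
Implicit Types (u v w : word G) (g h k : raag G).

Definition inv_word w : word G := rev (map (@inv_letter G) w).

Lemma inv_letterK : involutive (@inv_letter G).
Proof. by case=> x b; rewrite /inv_letter /= negbK. Qed.

Lemma inv_wordK : involutive inv_word.
Proof. by move=> w; rewrite /inv_word map_rev revK (mapK inv_letterK). Qed.

Lemma raag_cong_ctx u v w1 w2 :
  raag_cong w1 w2 -> raag_cong (u ++ w1 ++ v) (u ++ w2 ++ v).
Proof.
elim=> [w|x y _|x y z _ h1 _ h2|x y a|x y a b ab].
- exact: raag_refl.
- exact: raag_sym.
- exact: raag_trans h1 h2.
- by have := raag_cancel (u ++ x) (y ++ v) a; rewrite -!catA.
- by have := raag_comm (u ++ x) (y ++ v) ab; rewrite -!catA.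
Qed.

Lemma raag_cong_cat u u' v v' :
  raag_cong u u' -> raag_cong v v' -> raag_cong (u ++ v) (u' ++ v').
Proof.
move=> /(raag_cong_ctx [::] v) /= h1 /(raag_cong_ctx u' [::]).
by rewrite !cats0; exact: raag_trans.
Qed.

Lemma raag_cong_catV w : raag_cong (w ++ inv_word w) [::].
Proof.
elim: w => [|a w IH]; first exact: raag_refl.
rewrite /inv_word /= rev_cons -cats1.
have := raag_cong_ctx [:: a] [:: inv_letter a] IH.
rewrite /= -!catA => h; apply: (raag_trans h).
exact: (raag_cancel [::] [::] a).
Qed.

Lemma raag_cong_inv u v : raag_cong u v -> raag_cong (inv_word u) (inv_word v).
Proof.
move=> uv; have h1 := raag_cong_ctx (inv_word u) (inv_word v) uv.
have h2 := raag_cong_ctx (inv_word u) [::] (raag_cong_catV v).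
have h3 := raag_cong_ctx [::] (inv_word v) (raag_cong_catV (inv_word u)).
rewrite inv_wordK /= -!catA in h3; rewrite !cats0 in h2.
exact: raag_trans (raag_sym h2) (raag_trans (raag_sym h1) h3).
Qed.

Definition raag_mul g h : raag G := \pi_(raag G) (repr g ++ repr h).
Definition raag_one : raag G := \pi_(raag G) [::].
Definition raag_inv g : raag G := \pi_(raag G) (inv_word (repr g)).

Lemma raag_repr w : raag_cong (repr (\pi_(raag G) w)) w.
Proof. by apply/raag_eqP; rewrite reprK. Qed.

Lemma raag_mul_pi u v :
  raag_mul (\pi_(raag G) u) (\pi_(raag G) v) = \pi_(raag G) (u ++ v).
Proof. by apply/raag_eqP; apply: raag_cong_cat; exact: raag_repr. Qed.

Lemma raag_inv_pi u :
  raag_inv (\pi_(raag G) u) = \pi_(raag G) (inv_word u).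
Proof. by apply/raag_eqP; apply: raag_cong_inv; exact: raag_repr. Qed.

Lemma raag_surj g : exists w, g = \pi_(raag G) w.
Proof. by exists (repr g); rewrite reprK. Qed.

Lemma raag_mulA : associative raag_mul.
Proof.
move=> g h k; case: (raag_surj g) (raag_surj h) (raag_surj k).
by move=> u -> [v ->] [w ->]; rewrite !raag_mul_pi catA.
Qed.

Lemma raag_mul1 : left_id raag_one raag_mul.
Proof. by move=> g; case: (raag_surj g) => w ->; rewrite raag_mul_pi. Qed.

Lemma raag_mulr1 : right_id raag_one raag_mul.
Proof.
by move=> g; case: (raag_surj g) => w ->; rewrite raag_mul_pi cats0.
Qed.

Lemma raag_mulV : left_inverse raag_one raag_inv raag_mul.
Proof.
move=> g; case: (raag_surj g) => w ->; rewrite raag_inv_pi raag_mul_pi.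
by apply/raag_eqP; have := raag_cong_catV (inv_word w); rewrite inv_wordK.
Qed.

Lemma raag_mulrV : right_inverse raag_one raag_inv raag_mul.
Proof.
move=> g; case: (raag_surj g) => w ->; rewrite raag_inv_pi raag_mul_pi.
by apply/raag_eqP; exact: raag_cong_catV.
Qed.

HB.instance Definition _ := isGroup.Build (raag G)
  raag_mulA raag_mul1 raag_mulr1 raag_mulV raag_mulrV.

Local Open Scope group_scope.

Definition raag_gen (v : vert G) : raag G := \pi_(raag G) [:: (v, false)].

Definition letter_val (a : letter G) : raag G :=
  if a.2 then (raag_gen a.1)^-1 else raag_gen a.1.

Definition word_val (w : word G) : raag G := \prod_(a <- w) letter_val a.

Lemma word_valE (w : word G) : word_val w = \pi_(raag G) w.
Proof.
rewrite /word_val; elim: w => [|a w IH]; first by rewrite big_nil.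
rewrite big_cons IH; case: a => x [] /=; last exact: raag_mul_pi.
by rewrite /letter_val /= [_^-1]raag_inv_pi; exact: raag_mul_pi.
Qed.

Lemma word_length_subproof (g : raag G) :
  exists n, `[< exists2 w : word G, size w = n & word_val w = g >].
Proof.
exists (size (repr g)); apply/asboolP; exists (repr g) => //.
by rewrite word_valE reprK.
Qed.

Definition word_length (g : raag G) : nat := ex_minn (word_length_subproof g).

End RaagGroup.

(** * Cube complexes *)

(* An isometric embedding of [0,1]^m onto an m-dimensional face of [0,1]^n is
   determined by the image [base] of the origin and by the axis [dir i] parallel
   to which the i-th edge at the origin is sent.  For m = n these are the 2^n n!
   isometries of the n-cube. *)
Record cube_emb (m n : nat) := CubeEmb {
  base : {ffun 'I_n -> bool};
  dir : {ffun 'I_m -> 'I_n};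
  dir_inj : injectiveb dir
}.

(* The action on the corners {0,1}^m of the cube. *)
Definition emb_corner m n (f : cube_emb m n) (x : {ffun 'I_m -> bool}) :
  {ffun 'I_n -> bool} :=
  [ffun j => base f j (+) [exists i, (dir f i == j) && x i]].

Lemma id_dir_inj n : injectiveb [ffun i : 'I_n => i].
Proof. by apply/injectiveP => i j; rewrite !ffunE. Qed.

Definition emb_id n : cube_emb n n :=
  CubeEmb [ffun => false] (id_dir_inj n).

Lemma comp_dir_inj m n r (f : cube_emb n r) (g : cube_emb m n) :
  injectiveb [ffun i => dir f (dir g i)].
Proof.
apply/injectiveP => i j; rewrite !ffunE.
by move=> /(injectiveP _ (dir_inj f)) /(injectiveP _ (dir_inj g)).
Qed.

Definition emb_comp m n r (f : cube_emb n r) (g : cube_emb m n) :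
  cube_emb m r :=
  CubeEmb (emb_corner f (base g)) (comp_dir_inj f g).

Lemma corner_dir_inj n (d : 'I_0 -> 'I_n) : injectiveb [ffun i => d i].
Proof. by apply/injectiveP => -[]. Qed.

Definition corner_emb n (p : {ffun 'I_n -> bool}) : cube_emb 0 n :=
  CubeEmb p (corner_dir_inj (fun i : 'I_0 => False_rect _ (notF (ltn_ord i)))).

Lemma axis_dir_inj n (i : 'I_n) : injectiveb [ffun _ : 'I_1 => i].
Proof. by apply/injectiveP => a b _; rewrite [a]ord1 [b]ord1. Qed.

Definition axis_emb n (i : 'I_n) : cube_emb 1 n :=
  CubeEmb [ffun => false] (axis_dir_inj i).

(* An element of [cube X n] is an n-cube of X together with an isometric
   parametrization by [0,1]^n, i.e. a choice of one of its corners and of an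
   ordering of its n edges at that corner.  So [cube X 0] is the set of 0-cubes,
   [cube X 1] the set of oriented 1-cubes (equivalently, of ends of 1-cubes),
   and each n-cube occurs as a free orbit of size 2^n n! in [cube X n].  The map
   [restr f] precomposes the parametrization with f, which records how the faces
   are glued by isometries.  Cubes need not be embedded, and distinct cubes may
   share several faces. *)
Record cube_complex := CubeComplex {
  cube : nat -> Type;
  restr : forall m n, cube_emb m n -> cube n -> cube m;
  restr_id : forall n (c : cube n), restr (emb_id n) c = c;
  restr_comp : forall m n r (f : cube_emb n r) (g : cube_emb m n) (c : cube r),
    restr (emb_comp f g) c = restr g (restr f c);
  restr_free : forall n (s : cube_emb n n) (c : cube n),
    restr s c = c -> s = emb_id n
}.

(* The corner of c at the origin of its parametrization, and the end at that
   corner of the 1-cube along the i-th axis. *)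
Definition origin (X : cube_complex) n (c : cube X n) : cube X 0 :=
  restr (corner_emb [ffun => false]) c.
Definition axis (X : cube_complex) n (c : cube X n) (i : 'I_n) : cube X 1 :=
  restr (axis_emb i) c.

Definition source (X : cube_complex) (a : cube X 1) : cube X 0 := origin a.
Definition target (X : cube_complex) (a : cube X 1) : cube X 0 :=
  restr (corner_emb [ffun => true]) a.

Fixpoint is_path (X : cube_complex) (x : cube X 0) (p : seq (cube X 1))
    (y : cube X 0) : Prop :=
  if p is a :: p' then source a = x /\ is_path (target a) p' y else x = y.

Definition cc_connected (X : cube_complex) : Prop :=
  forall x y : cube X 0, exists p, is_path x p y.

(* A cube complex is compact iff it has finitely many cubes. *)
Definition cc_compact (X : cube_complex) : Prop :=
  finite_set [set: {n : nat & cube X n}].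

Record comb_map (X Y : cube_complex) := CombMap {
  comb_fun :> forall n, cube X n -> cube Y n;
  comb_restr : forall m n (f : cube_emb m n) (c : cube X n),
    comb_fun (restr f c) = restr f (comb_fun c)
}.

(* Injectivity on a small neighbourhood of each 0-cube (hence near every point):
   distinct corners of cubes at a 0-cube have distinct images. *)
Definition locally_injective (X Y : cube_complex) (phi : comb_map X Y) : Prop :=
  forall n (c c' : cube X n), origin c = origin c' -> phi n c = phi n c' ->
  c = c'.

Definition local_isometry (Y X : cube_complex) (phi : comb_map Y X) : Prop :=
  locally_injective phi /\
  forall n (y : cube Y 0) (e : 'I_n -> cube Y 1),
    injective e -> (forall i, source (e i) = y) ->
  forall c : cube X n, origin c = phi 0 y ->
    (forall i, axis c i = phi 1 (e i)) ->
  exists c' : cube Y n,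
    [/\ origin c' = y, forall i, axis c' i = e i & phi n c' = c].

(* Inclusion of a subcomplex. *)
Definition embedding (X Y : cube_complex) (phi : comb_map X Y) : Prop :=
  forall n, injective (phi n).

(** * Salvetti complexes *)

Section Salvetti.
Variable G : sgraph.

Definition clique_letters n (c : {ffun 'I_n -> letter G}) : bool :=
  [forall i, forall j, (i != j) ==> adj (c i).1 (c j).1].

(* A parametrized n-cube of the torus of an n-clique: an ordering of the clique,
   and for each axis whether it is parametrized along the oriented 1-cube
   ([false]) or against it ([true]).  Opposite faces being identified, the
   restriction to a face depends on the coordinates fixed by the face, but not on
   their values. *)
Definition salvetti_cube n : Type :=
  {c : {ffun 'I_n -> letter G} | clique_letters c}.

Definition salvetti_restr_fun m n (f : cube_emb m n)
    (c : {ffun 'I_n -> letter G}) : {ffun 'I_m -> letter G} :=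
  [ffun i => ((c (dir f i)).1, (c (dir f i)).2 (+) base f (dir f i))].

Lemma salvetti_restr_subproof m n (f : cube_emb m n) (c : salvetti_cube n) :
  clique_letters (salvetti_restr_fun f (val c)).
Proof.
apply/forallP => i; apply/forallP => j; apply/implyP => ij; rewrite !ffunE /=.
have /forallP/(_ (dir f i))/forallP/(_ (dir f j))/implyP := valP c; apply.
by apply: contra ij => /eqP/(injectiveP _ (dir_inj f)) ->.
Qed.

Definition salvetti_restr m n (f : cube_emb m n) (c : salvetti_cube n) :
  salvetti_cube m :=
  exist (fun c => is_true (clique_letters c)) _ (salvetti_restr_subproof f c).

Lemma salvetti_restr_id n (c : salvetti_cube n) :
  salvetti_restr (emb_id n) c = c.
Proof.
apply: val_inj; apply/ffunP => i; rewrite !ffunE /= addbF.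
by case: (val c i).
Qed.

Lemma salvetti_restr_comp m n r (f : cube_emb n r) (g : cube_emb m n)
    (c : salvetti_cube r) :
  salvetti_restr (emb_comp f g) c = salvetti_restr g (salvetti_restr f c).
Proof.
apply: val_inj; apply/ffunP => i; rewrite !ffunE /=; congr (_, _).
rewrite -addbA; congr (_ (+) (_ (+) _)); apply/existsP/idP.
  by case=> j /andP[/eqP/(injectiveP _ (dir_inj f)) ->].
by move=> gi; exists (dir g i); rewrite eqxx.
Qed.

Lemma cube_emb_inj m n (f g : cube_emb m n) :
  base f = base g -> dir f = dir g -> f = g.
Proof.
case: f g => [b d i] [b' d' i'] /= eb ed; subst b' d'.
by rewrite (bool_irrelevance i i').
Qed.

Lemma salvetti_restr_free n (s : cube_emb n n) (c : salvetti_cube n) :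
  salvetti_restr s c = c -> s = emb_id n.
Proof.
move=> /(congr1 val) /ffunP sc.
have di i : dir s i = i.
  apply/eqP; apply: contraT => si.
  have /forallP/(_ (dir s i))/forallP/(_ i)/implyP/(_ si) := valP c.
  by have := sc i; rewrite !ffunE /= => <- /=; rewrite adj_irr.
apply: cube_emb_inj; apply/ffunP => i; rewrite !ffunE //=.
have := sc i; rewrite !ffunE /= di => /(congr1 snd) /=.
by case: (val c i).2; case: (base s i).
Qed.

Definition salvetti : cube_complex :=
  CubeComplex salvetti_restr_id salvetti_restr_comp salvetti_restr_free.

Lemma salvetti_base_subproof :
  clique_letters [ffun i : 'I_0 => False_rect (letter G) (notF (ltn_ord i))].
Proof. by apply/forallP => -[]. Qed.

Definition salvetti_base : cube salvetti 0 :=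
  exist (fun c => is_true (clique_letters c)) _ salvetti_base_subproof.

(* The element of A_G represented by a closed path in the Salvetti complex: the
   identification of the fundamental group with A_G, in which the oriented
   1-cube labelled v represents the generator v. *)
Definition edge_letter (a : cube salvetti 1) : letter G := val a ord0.
Definition path_val (p : seq (cube salvetti 1)) : raag G :=
  word_val (map edge_letter p).

End Salvetti.

(* The image of pi_1(Z, z) in A_G: every element of pi_1(Z, z) is the class of a
   closed combinatorial path at z. *)
Definition pi1_image (G : sgraph) (Z : cube_complex)
    (phi : comb_map Z (salvetti G)) (z : cube Z 0) : set (raag G) :=
  [set g | exists2 p, is_path z p z & path_val (map (phi 1) p) = g]%classic.

(* Main.v *)
Require Import Defs.
From mathcomp Require Import all_boot.
From mathcomp Require Import boolp classical_sets functions cardinality.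
From Stdlib Require Import Relation_Operators.

(** Why the theorem holds.  Call a partial action of A_G on a set T a family of
    partial injections of T, one for each generator, such that the ones of
    adjacent generators commute in the strong sense that two edges at a point
    with adjacent labels always span a square.  A local isometry to the
    Salvetti complex makes the 0-cubes of its source into a partial action
    ([isometry_action]), and conversely an action by permutations of X is the
    same thing as a covering of the Salvetti complex with set of 0-cubes X
    ([cover], [cover_isometry]).  A partial action extended to an action thus
    embeds Z into a covering ([lift_embedding]), in which every path lifts and
    the end of the lift depends only on the element of A_G that the path
    represents ([cover_lift], [reads_cong]).  So the task is to extend the
    partial action on the 0-cubes of Z to an action on at most |Z|(|g|+1) points
    in which g moves the base point ([separating_action]).

    On a finite set every partial action extends to an action on the same set:
    the orbits of a generator are cycles and lines, and each line is closed up
    by an edge from its end to its beginning.  Parallel lines have the same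
    length, so commuting is preserved ([close_lines_square], [completion]).
    This settles the matter if a geodesic word w for g can be read in Z from
    the base point, since it then ends elsewhere.  If instead w = u x v, where u
    can be read in Z and the letter x cannot be read next, let C be the set of
    points of Z at which x cannot be read.  Copies of C are stacked on top of Z,
    each glued to the one below by edges with one label.  The first label is x;
    then the letters of v are read in turn, a letter that commutes with the
    last label used is skipped, and any other letter labels a new layer
    ([chain]).  Inside a layer only those letters act that commute with all labels
    below it.  As w is reduced, consecutive labels neither commute nor cancel,
    and this makes the stack a partial action ([tower]).  In its completion, the
    skipped letters move within a layer and the others move one layer up, so
    reading w ends strictly above Z ([reads_above]).  There are at most |g|
    layers above Z, each with at most |Z| points. *)

Set Implicit Arguments.
Unset Strict Implicit.
Unset Printing Implicit Defensive.

(** * Reduced words *)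

Section Words.
Variable G : sgraph.
Implicit Types (a b l k : letter G) (w : word G).

Definition adjl a b : bool := adj a.1 b.1.

Lemma adjl_sym a b : adjl a b = adjl b a.
Proof. exact: adj_sym. Qed.

Lemma adjl_neq a b : adjl a b -> a.1 != b.1.
Proof. by apply: contraTneq; rewrite /adjl => ->; rewrite adj_irr. Qed.

Lemma raag_cong_head u w1 w2 : raag_cong w1 w2 -> raag_cong (u ++ w1) (u ++ w2).
Proof. by move=> h; have := @raag_cong_ctx G u [::] _ _ h; rewrite !cats0. Qed.

(** Conjugating by [a] turns a commutation with [a] into one with its inverse;
    this is how the defining relators, which involve generators only, give the
    commutation of letters of any signs. *)
Lemma raag_cong_swap_inv a b :
  raag_cong [:: a; b] [:: b; a] ->
  raag_cong [:: inv_letter a; b] [:: b; inv_letter a].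
Proof.
move=> /raag_sym/(@raag_cong_ctx G [:: inv_letter a] [:: inv_letter a]) /= h.
have h1 := @raag_cancel G [:: inv_letter a; b] [::] a.
have h2 := @raag_cancel G [::] [:: b; inv_letter a] (inv_letter a).
rewrite inv_letterK in h2.
exact: raag_trans (raag_sym h1) (raag_trans h h2).
Qed.

Lemma raag_cong_swap a b : adjl a b -> raag_cong [:: a; b] [:: b; a].
Proof.
suff pos (x y : vert G) : adj x y ->
    raag_cong [:: (x, false); (y, false)] [:: (y, false); (x, false)].
  case: a b => [x i] [y j]; rewrite /adjl /= => xy.
  have pos' : raag_cong [:: (x, i); (y, false)] [:: (y, false); (x, i)].
    case: i; last exact: pos.
    by apply: (@raag_cong_swap_inv (x, false)); exact: pos.
  case: j => //; apply: raag_sym; apply: (@raag_cong_swap_inv (y, false)).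
  exact: raag_sym.
move=> xy; have c1 := @raag_comm G [::] [:: (y, false); (x, false)] _ _ xy.
have c2 := @raag_cancel G [:: (x, false); (y, false); (x, true)]
             [:: (x, false)] (y, true).
have c3 := @raag_cancel G [:: (x, false); (y, false)] [::] (x, true).
exact: raag_trans (raag_sym (raag_trans c2 c3)) c1.
Qed.

Fixpoint uncancelled a w : bool :=
  if w is b :: w' then if adjl a b then uncancelled a w' else b != inv_letter a
  else true.

Fixpoint reduced w : bool :=
  if w is a :: w' then uncancelled a w' && reduced w' else true.

Lemma uncancelledPn a w : ~~ uncancelled a w ->
  exists2 w', size w' < size w & raag_cong (a :: w) w'.
Proof.
elim: w => [//|b w IH] /=; case: ifP => [ab /IH [w' sz h]|_ /negPn/eqP ->].
  exists (b :: w') => //; apply: raag_trans (raag_cong_head [:: b] h).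
  exact: (@raag_cong_ctx G [::] w _ _ (raag_cong_swap ab)).
by exists w => //; exact: (@raag_cancel G [::] w a).
Qed.

(** A cancelling pair separated by letters that commute with it can be removed,
    which shortens the word. *)
Lemma minimal_reduced w :
  (forall w', raag_cong w w' -> size w <= size w') -> reduced w.
Proof.
elim: w => [//|a w IH] min /=; apply/andP; split.
  apply/negPn/negP => /uncancelledPn[w' sz /min] /=.
  by rewrite leqNgt ltnS (ltnW sz).
apply: IH => w' h; exact: (min (a :: w') (raag_cong_head [:: a] h)).
Qed.

Lemma word_length_geodesic (g : raag G) :
  exists w, [/\ word_val w = g, size w = word_length g & reduced w].
Proof.
rewrite /word_length; case: ex_minnP => n /asboolP[w sz wg] min.
exists w; split=> //; apply: minimal_reduced => w' h.
rewrite sz; apply: min; apply/asboolP; exists w' => //.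
by rewrite -wg !word_valE; apply/raag_eqP/raag_sym.
Qed.

(** The labels of the layers of the tower: starting from the label [x], a letter
    that commutes with the last label is skipped. *)
Fixpoint chain x w : seq (letter G) :=
  if w is y :: w' then if adjl x y then chain x w' else y :: chain y w' else [::].

Lemma size_chain x w : size (chain x w) <= size w.
Proof.
by elim: w x => [//|y w IH] x /=; case: ifP => _; [exact: leqW | exact: IH].
Qed.

Definition stacks : rel (letter G) := fun a b => ~~ adjl a b && (b != inv_letter a).

(** The letters skipped since the last label all commute with it, so a letter
    inverse to the label would cancel it. *)
Lemma chain_stacks x w : uncancelled x w -> reduced w -> path stacks x (chain x w).
Proof.
elim: w x => [//|y w IH] x /=; case: ifP => xy ux /andP[uy rw] /=; first exact: IH.
by rewrite /stacks xy ux IH.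
Qed.

Lemma sorted_onth (xs : seq (letter G)) i a b :
  sorted stacks xs -> onth xs i = Some a -> onth xs i.+1 = Some b -> stacks a b.
Proof.
elim: xs i => [|x xs IH] [|i] //=.
  by case: xs {IH} => [//|y xs] /= /andP[xy _] [<-] [<-].
by move=> /path_sorted; exact: IH.
Qed.

End Words.

(** * Partial actions *)

Section PartialActions.
Variable G : sgraph.
Implicit Types (a b l k : letter G) (w : word G).

Definition square T (R Q : T -> T -> Prop) : Prop :=
  forall s t u, R s t -> Q s u -> exists2 r, Q t r & R u r.

Lemma square_sym T (R Q : T -> T -> Prop) : square R Q -> square Q R.
Proof. by move=> h s t u st su; case: (h s u t su st) => r; exists r. Qed.

(** The inverse of a generator has its own relation, so that [step_fun] also
    expresses injectivity and [step_square] covers all four choices of signs. *)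
Record paction (T : Type) := PAction {
  step :> letter G -> T -> T -> Prop;
  step_inv : forall l s t, step l s t -> step (inv_letter l) t s;
  step_fun : forall l s t t', step l s t -> step l s t' -> t = t';
  step_square : forall l k, adjl l k -> square (step l) (step k)
}.

Lemma step_invV T (A : paction T) l s t : A (inv_letter l) s t -> A l t s.
Proof. by move=> st; have := step_inv st; rewrite inv_letterK. Qed.

Definition total_action T (A : paction T) : Prop := forall l s, exists t, A l s t.

Fixpoint reads T (A : paction T) w (s t : T) : Prop :=
  if w is l :: w' then exists2 r, A l s r & reads A w' r t else s = t.

Lemma reads_cat T (A : paction T) w1 w2 s t :
  reads A (w1 ++ w2) s t <-> exists2 r, reads A w1 s r & reads A w2 r t.
Proof.
elim: w1 s => [|l w IH] s /=; first by split=> [|[r <-]//]; exists s.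
split=> [[r sr /IH[r' h1 h2]]|[r' [r sr h1] h2]].
  by exists r' => //; exists r.
by exists r => //; apply/IH; exists r'.
Qed.

Lemma reads_fun T (A : paction T) w s t t' :
  reads A w s t -> reads A w s t' -> t = t'.
Proof.
elim: w s => [|l w IH] s /=; first by move=> <-.
by move=> [r sr h] [r' sr' h']; rewrite (step_fun sr' sr) in h'; exact: IH h h'.
Qed.

Lemma reads_sub T U (A : paction T) (B : paction U) (f : T -> U) w s t :
  (forall l s t, A l s t -> B l (f s) (f t)) ->
  reads A w s t -> reads B w (f s) (f t).
Proof.
move=> AB; elim: w s => [|l w IH] s /=; first by move=> ->.
by case=> r /AB sr /IH; exists (f r).
Qed.

Lemma reads_stuck T (A : paction T) w s :
  (exists t, reads A w s t) \/
  exists u x v p, [/\ w = u ++ x :: v, reads A u s p & forall t, ~ A x p t].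
Proof.
elim: w s => [|l w IH] s; first by left; exists s.
case: (pselect (exists r, A l s r)) => [[r sr]|no].
  case: (IH r) => [[t rt]|[u [x [v [p [-> rp no]]]]]].
    by left; exists t, r.
  by right; exists (l :: u), x, v, p; split=> //; exists r.
by right; exists [::], l, w, s; split=> // t st; apply: no; exists t.
Qed.

(** In a total action the two words of a defining relation act in the same way,
    because the words that are inserted or deleted act as the identity. *)
Lemma reads_cong T (A : paction T) : total_action A ->
  forall w1 w2, raag_cong w1 w2 -> forall s t, reads A w1 s t <-> reads A w2 s t.
Proof.
move=> tA.
have del u v w : (forall s, reads A v s s) ->
    forall s t, reads A (u ++ v ++ w) s t <-> reads A (u ++ w) s t.
  move=> vid s t; split=> /reads_cat[r h1 h2]; apply/reads_cat; exists r => //.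
    by move/reads_cat: h2 => [r' h h']; rewrite (reads_fun (vid r) h).
  by apply/reads_cat; exists r.
move=> w1 w2; elim=> {w1 w2} [//|w1 w2 _ IH|w1 w2 w3 _ h1 _ h2|u w l|u w x y xy] s t.
- exact: iff_sym.
- exact: iff_trans (h1 s t) (h2 s t).
- apply: del => {}s; have [r sr] := tA l s.
  by exists r => //; exists s => //; exact: step_inv.
- apply: del => {}s.
  have [r sr] := tA (x, false) s; have [q rq] := tA (y, false) r.
  have xy' : adjl (x, true) (y, false) by [].
  have [p sp qp] := step_square xy' (step_inv sr) rq.
  exists r => //; exists q => //; exists p => //; exists s => //.
  exact: (step_inv sp).
Qed.

(** * Completing partial actions *)

(** [R'] is meant to be the converse of [R].  The orbits of the partial injection
    [R] are cycles and lines, and the new edges go from the end of each line to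
    its beginning, which is reached by following [R'].  Giving the converse as a
    separate relation makes the construction symmetric: the completion of the
    converse is the converse of the completion. *)
Section CloseLines.
Variables (T : Type) (R R' : T -> T -> Prop).

Local Notation reach := (clos_refl_trans_1n T).

Definition close_lines s t : Prop :=
  R s t \/ [/\ forall r, ~ R s r, forall r, ~ R' t r & reach R' s t].

End CloseLines.

Section CloseLinesTheory.
Variables (T : Type) (R R' : T -> T -> Prop).
Hypotheses (RV : forall s t, R s t -> R' t s) (R'V : forall s t, R' s t -> R t s).
Hypotheses (R_fun : forall s t t', R s t -> R s t' -> t = t')
           (R'_fun : forall s t t', R' s t -> R' s t' -> t = t').
Local Notation reach := (clos_refl_trans_1n T).

Lemma reach_snoc (Q : T -> T -> Prop) s t r : reach Q s t -> Q t r -> reach Q s r.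
Proof.
elim=> [x xr|x y z xy _ IH /IH]; last exact: rt1n_trans.
by apply: rt1n_trans xr _; exact: rt1n_refl.
Qed.

Lemma reach_inv s t : reach R' s t -> reach R t s.
Proof.
elim=> [x|x y z xy _ IH]; first exact: rt1n_refl.
by apply: reach_snoc IH _; exact: R'V.
Qed.

Lemma close_lines_inv s t : close_lines R R' s t -> close_lines R' R t s.
Proof.
by case=> [/RV|[ns nt st]]; [left|right; split=> //; exact: reach_inv].
Qed.

Lemma close_lines_fun s t t' :
  close_lines R R' s t -> close_lines R R' s t' -> t = t'.
Proof.
case=> [st|[ns nt st]] [st'|[ns' nt' st']].
- exact: R_fun st st'.
- by case: (ns' t).
- by case: (ns t').
- elim: st st' nt => {s t ns ns'} [x|x y z xy _ IH] xt' nz.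
    by case: xt' nt' => // y z xy; case: (nz y).
  case: xt' nt' IH => [nx|y' z' xy' yz' nz' IH]; first by case: (nx y).
  by apply: IH => //; rewrite (R'_fun xy xy').
Qed.

(** A [Q]-edge at a point of an [R]-line can be transported along the line, and
    by the squares with [Q'] the points across it are ends or beginnings of lines
    exactly when the original ones are. *)
Lemma close_lines_square (Q Q' : T -> T -> Prop) :
  (forall s t, Q s t -> Q' t s) ->
  square R Q -> square R' Q -> square R Q' -> square R' Q' ->
  square (close_lines R R') Q.
Proof.
move=> QV RQ R'Q RQ' R'Q' s t u [st|[ns nt st]] su.
  by have [r tr ur] := RQ _ _ _ st su; exists r => //; left.
have nu : forall r, ~ R u r.
  by move=> r ur; have [q _ /ns] := RQ' _ _ _ ur (QV _ _ su).
suff [r tr ur] : exists2 r, Q t r & reach R' u r.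
  exists r => //; right; split=> // q rq.
  by have [p _ /nt] := R'Q' _ _ _ rq (QV _ _ tr).
elim: st u su {ns nt nu} => {s t} [x|x y z xy _ IH] u xu.
  by exists u => //; exact: rt1n_refl.
have [v yv uv] := R'Q _ _ _ xy xu; have [r zr vr] := IH _ yv.
by exists r => //; apply: rt1n_trans vr.
Qed.

(** If the line behind a point without outgoing edge had no beginning, following
    it backwards would give infinitely many distinct points. *)
Lemma close_lines_total : finite_set [set: T] ->
  forall s, exists t, close_lines R R' s t.
Proof.
move=> finT s; apply: contrapT => no.
have ns : forall r, ~ R s r by move=> r sr; apply: no; exists r; left.
have step_back t : exists r, reach R' s t -> R' t r.
  case: (pselect (exists r, R' t r)) => [[r tr]|nt]; first by exists r.
  exists t => st; case: no; exists t; right; split=> // r tr.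
  by apply: nt; exists r.
have [b bP] := choice step_back.
have reachb n : reach R' s (iter n b s).
  by elim: n => [|n IH] /=; [exact: rt1n_refl | exact: reach_snoc IH (bP _ IH)].
have fwd n : R (iter n.+1 b s) (iter n b s) by exact: R'V (bP _ (reachb n)).
have lt_neq i j : i < j -> iter i b s <> iter j b s.
  elim: i j => [|i IH] [//|j] ij eq_ij.
    by apply: (ns (iter j b s)); have := fwd j; rewrite -eq_ij.
  apply: (IH j ij); apply: (@R_fun (iter i.+1 b s)); first exact: fwd.
  by rewrite eq_ij; exact: fwd.
have inj : injective (fun n => iter n b s).
  by move=> i j eq_ij; case: (ltngtP i j) => // /lt_neq; rewrite eq_ij.
apply: infinite_nat.
have := sub_finite_set (@subsetT _ (range (fun n => iter n b s))) finT.
by rewrite (eq_finite_set (inj_card_eq (in2W inj))).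
Qed.

End CloseLinesTheory.

Section Completion.
Variables (T : Type) (A : paction T).

Definition close_step l : T -> T -> Prop := close_lines (A l) (A (inv_letter l)).

Lemma close_step_inv l s t : close_step l s t -> close_step (inv_letter l) t s.
Proof.
move=> st; rewrite /close_step inv_letterK.
exact: (close_lines_inv (@step_inv _ A l) (@step_invV _ A l) st).
Qed.

Lemma close_step_fun l s t t' : close_step l s t -> close_step l s t' -> t = t'.
Proof. by apply: close_lines_fun; exact: step_fun. Qed.

Lemma close_step_square l k : adjl l k -> square (close_step l) (close_step k).
Proof.
have half a b : adjl a b -> square (A b) (close_step a).
  move=> ab; apply: square_sym; apply: close_lines_square (@step_inv _ A b) _ _ _ _;
  exact: step_square.
move=> lk; apply: square_sym; rewrite adjl_sym in lk.
apply: close_lines_square (@close_step_inv l) _ _ _ _; apply: half;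
by rewrite adjl_sym.
Qed.

Definition completion : paction T :=
  PAction close_step_inv close_step_fun close_step_square.

Lemma sub_completion l s t : A l s t -> completion l s t.
Proof. by left. Qed.

Lemma completion_total : finite_set [set: T] -> total_action completion.
Proof.
move=> finT l; apply: close_lines_total => //; last exact: step_fun.
exact: step_invV.
Qed.

(** New edges join points of the same line, so they do not leave a set that is
    closed under the generator and its inverse. *)
Lemma completion_stable (P : T -> Prop) l :
  (forall s t, P s -> A l s t -> P t) ->
  (forall s t, P s -> A (inv_letter l) s t -> P t) ->
  forall s t, P s -> completion l s t -> P t.
Proof.
move=> h h' s t Ps [/h|[_ _ st]]; first exact.
by elim: st Ps => // x y z xy _ IH Px; apply: IH; exact: h' xy.
Qed.

End Completion.
End PartialActions.

(** * Stacking layers on a partial action *)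

Lemma onth_pred (T : Type) (s : seq T) i y :
  onth s i.+1 = Some y -> exists x, onth s i = Some x.
Proof. by elim: s i => [|x s IH] [|i] //=; [exists x | exact: IH]. Qed.

Section Tower.
Variables (G : sgraph) (T : Type) (A : paction G T).
Variables (xs : seq (letter G)) (N : nat).
Hypothesis xs_stacks : sorted (@stacks G) xs.
Implicit Types (l k x y : letter G) (w : word G) (c : T) (s t : T * 'I_N).

(** With [xs] empty every point is exposed, and the tower is a disjoint union of
    copies of the given partial action. *)
Definition exposed c : Prop := forall x, onth xs 0 = Some x -> forall d, ~ A x c d.

Definition links l i : Prop := forall j x, j < i -> onth xs j = Some x -> adjl x l.

(** Level 0 is the given partial action.  On a higher level only edges between
    exposed points are kept, and of these only the ones whose label commutes with
    all labels below.  The points that are not exposed stay there as isolated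
    points, so that the vertex set is a plain product. *)
Variant tower_step l s t : Prop :=
| Level of s.2 = t.2 :> nat & (0 < s.2 -> exposed s.1) & links l s.2
    & A l s.1 t.1
| Up of t.2 = s.2.+1 :> nat & onth xs s.2 = Some l & exposed s.1 & t.1 = s.1
| Down of s.2 = t.2.+1 :> nat & onth xs t.2 = Some (inv_letter l) & exposed s.1
    & t.1 = s.1.

Lemma links_up l i x : links l i -> onth xs i = Some x -> adjl x l -> links l i.+1.
Proof.
move=> li xi xl j y; rewrite ltnS leq_eqVlt => /orP[/eqP->|]; last exact: li.
by rewrite xi => -[<-].
Qed.

Lemma links_down l i : links l i.+1 -> links l i.
Proof. by move=> li j y /ltnW; exact: li. Qed.

Lemma onth_stacks i x y : onth xs i = Some x -> onth xs i.+1 = Some y -> stacks x y.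
Proof. exact: sorted_onth. Qed.

(** An edge whose label commutes with the first label [x] of the tower preserves
    exposed points: an [x]-edge at its end would be carried back by a square. *)
Lemma exposed_step l i c d : links l i.+1 -> exposed c -> A l c d -> exposed d.
Proof.
move=> li ec cd x x0 e de; have xl : adjl x (inv_letter l) by exact: li x0.
have [r _ cr] := step_square xl de (step_inv cd).
exact: ec x0 _ cr.
Qed.

Lemma tower_inv l s t : tower_step l s t -> tower_step (inv_letter l) t s.
Proof.
case=> [st es ls cd|st sl es e|st tl es e].
- apply: Level; rewrite -?st //; last exact: step_inv.
  case: (s.2 : nat) es ls => [//|i] es ls _.
  exact: exposed_step ls (es _) cd.
- by apply: Down; rewrite ?inv_letterK ?e.
- by apply: Up; rewrite ?e.
Qed.

(** A conflict between two edges of different kinds would need a label that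
    commutes with itself or with the next one, or that cancels the next one, or
    an exposed point with an edge labelled by the first letter of the tower. *)
Lemma tower_fun l s t t' : tower_step l s t -> tower_step l s t' -> t = t'.
Proof.
suff key : tower_step l s t -> tower_step l s t' -> t.1 = t'.1 /\ t.2 = t'.2 :> nat.
  move=> st st'; case: (key st st').
  by case: t t' {st st' key} => [c i] [c' i'] /= -> /val_inj ->.
(* No point has both a level edge and an upward edge with one label. *)
have level_up i : (0 < i -> exposed s.1) -> links l i -> onth xs i = Some l ->
    exposed s.1 -> forall d, ~ A l s.1 d.
  case: i => [|i] _ ll xi es d sd; first exact: es xi _ sd.
  have [y yi] := onth_pred xi.
  by have := onth_stacks yi xi; rewrite /stacks (ll i y).
have level_down i : links l i.+1 -> ~ onth xs i = Some (inv_letter l).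
  by move=> ll /(ll i _ (ltnSn i))/adjl_neq; rewrite eqxx.
have up_down i : onth xs i.+1 = Some l -> ~ onth xs i = Some (inv_letter l).
  by move=> li1 li; have := onth_stacks li li1;
    rewrite /stacks inv_letterK eqxx andbF.
case=> [e es ls sd|e sl es d|e tl es d] [e' es' ls' sd'|e' sl' es' d'|e' tl' es' d'].
- by rewrite (step_fun sd sd') -e.
- by case: (level_up _ es ls sl' es' _ sd).
- by rewrite e' in ls; case: (level_down _ ls tl').
- by case: (level_up _ es' ls' sl es _ sd').
- by rewrite d d' e e'.
- by rewrite e' in sl; case: (up_down _ sl tl').
- by rewrite e in ls'; case: (level_down _ ls' tl).
- by rewrite e in sl'; case: (up_down _ sl' tl).
- by rewrite d d'; split=> //; apply: succn_inj; rewrite -e.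
Qed.

(** Two vertical edges at a point never have adjacent labels, since consecutive
    labels do not commute.  A level edge whose label commutes with that of a
    vertical edge occurs on both levels that the vertical edge joins. *)
Lemma tower_square l k : adjl l k -> square (tower_step l) (tower_step k).
Proof.
have upd x y (s t u : T * 'I_N) : adjl x y ->
    onth xs s.2 = Some x -> exposed s.1 -> t.2 = s.2.+1 :> nat -> t.1 = s.1 ->
    tower_step y s u -> exists2 r, tower_step y t r & tower_step x u r.
  move=> xy sx es ts t1 [su _ ls sd|us sy _ _|su uy _ _].
  - have ly := links_up ls sx xy.
    exists (u.1, t.2); first by apply: Level => //=; rewrite ?ts ?t1.
    apply: Up => //=; rewrite -?su //; exact: exposed_step ly es sd.
  - by move: sy xy; rewrite sx => -[->] /adjl_neq; rewrite eqxx.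
  - have := onth_stacks uy; rewrite -su => /(_ _ sx).
    by rewrite /stacks adjl_sym (_ : adjl x (inv_letter y)).
have down x y (s t u : T * 'I_N) : adjl x y ->
    onth xs t.2 = Some (inv_letter x) -> exposed s.1 -> s.2 = t.2.+1 :> nat ->
    t.1 = s.1 ->
    tower_step y s u -> exists2 r, tower_step y t r & tower_step x u r.
  move=> xy tx es st t1 [su _ ls sd|us sy _ _|su uy _ _].
  - rewrite st in ls; exists (u.1, t.2).
      by apply: Level => //=; rewrite ?t1 //; exact: links_down.
    apply: Down => //=; rewrite -?su //; exact: exposed_step ls es sd.
  - have := onth_stacks tx; rewrite -st => /(_ _ sy).
    by rewrite /stacks (_ : adjl (inv_letter x) y).
  - have tu : t.2 = u.2 :> nat by apply: succn_inj; rewrite -st.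
    by move: uy xy; rewrite -tu tx => -[e _]; rewrite /adjl e adj_irr.
move=> lk s t u [st es ls sd|ts sl es t1|st tl es t1] su; last 2 first.
- exact: upd su.
- exact: down su.
case: su => [su eu lu su'|us sk es' u1|su uk es' u1].
- have [r tr ur] := step_square lk sd su'.
  exists (r, s.2).
    apply: Level => //=; rewrite -?st //.
    case: (s.2 : nat) es ls => [//|i] es ls _; exact: exposed_step ls (es _) sd.
  apply: Level => //=; rewrite -?su //.
  case: (s.2 : nat) es lu => [//|i] es lu _; exact: exposed_step lu (es _) su'.
- rewrite adjl_sym in lk; have lv : tower_step l s t by exact: Level.
  by have [r] := upd k l s u t lk sk es' us u1 lv; exists r.
- rewrite adjl_sym in lk; have lv : tower_step l s t by exact: Level.
  by have [r] := down k l s u t lk uk es' su u1 lv; exists r.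
Qed.

Definition tower : paction G (T * 'I_N) := PAction tower_inv tower_fun tower_square.

Lemma tower_ground l c d (o : 'I_N) :
  o = 0 :> nat -> A l c d -> tower l (c, o) (d, o).
Proof. by move=> o0 cd; apply: Level => //=; rewrite o0. Qed.

(** Invariant of the reading: the current point is exposed and lies one level
    above the position of the last label [x], and the labels still ahead are the
    chain of the letters still to be read.  The exposed points of a level are
    closed under the letters adjacent to [x], also after completion. *)
Lemma reads_above w x i c (o : 'I_N) :
  total_action (completion tower) -> size xs < N ->
  o = i.+1 :> nat -> onth xs i = Some x -> exposed c -> drop i.+1 xs = chain x w ->
  exists2 t, reads (completion tower) w (c, o) t & 0 < t.2.
Proof.
move=> tot szN; elim: w x i c o => [|y w IH] x i c o oi xi ec /=.
  by move=> _; exists (c, o); rewrite /= ?oi.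
case: ifP => [xy ch|_ ch].
  have [[d o'] st] := tot y (c, o).
  have stab z : adjl x z -> forall s t, exposed s.1 /\ s.2 = i.+1 :> nat ->
      tower z s t -> exposed t.1 /\ t.2 = i.+1 :> nat.
    move=> xz s t [es si] [ts _ ls sd|_ sz _ _|ss tz _ _].
    - by rewrite -ts si; split=> //; rewrite si in ls; exact: exposed_step ls es sd.
    - by have := onth_stacks xi; rewrite -si => /(_ _ sz); rewrite /stacks xz.
    - have ti : t.2 = i :> nat by apply: succn_inj; rewrite -ss.
      by move: tz xz; rewrite ti xi => -[->] /adjl_neq; rewrite eqxx.
  have [ed o'i] := completion_stable (stab y xy) (stab (inv_letter y) xy)
                     (conj ec oi : exposed (c, o).1 /\ _) st.
  have [t dt t0] := IH x i d o' o'i xi ed ch.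
  by exists t => //; exists (d, o').
have yi : onth xs i.+1 = Some y.
  by elim: (xs) (i.+1) ch => [|a s IHs] [|m] //= => [[->]//|/IHs].
have ltN : i.+2 < N.
  apply: leq_ltn_trans szN; rewrite ltnNge; apply/negP => le.
  by move: ch; rewrite drop_oversize.
have ch' : drop i.+2 xs = chain y w by rewrite -add1n -drop_drop ch /= drop0.
have [t st t0] := IH y i.+1 c (Ordinal ltN) erefl yi ec ch'.
exists t => //; exists (c, Ordinal ltN) => //.
by apply: sub_completion; apply: Up => //=; rewrite oi.
Qed.

End Tower.

(** If [w] can be read entirely, copies of the given partial action are completed;
    otherwise the tower starts at the letter where the reading stops. *)
Theorem separating_action (G : sgraph) (T : Type) (A : paction G T) (z : T)
    (w : word G) (o : 'I_(size w).+1) :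
  finite_set [set: T] -> o = 0 :> nat -> reduced w -> ~ reads A w z z ->
  exists B : paction G (T * 'I_(size w).+1),
    [/\ total_action B, forall l c d, A l c d -> B l (c, o) (d, o)
      & ~ reads B w (z, o) (z, o)].
Proof.
move=> finT o0 rw nz.
have finX : finite_set [set: T * 'I_(size w).+1].
  by rewrite -setXTT; apply: finite_setX => //; exact: finite_finset.
have ground xs (sxs : sorted (@stacks G) xs) l c d : A l c d ->
    completion (tower A (size w).+1 sxs) l (c, o) (d, o).
  by move=> cd; apply: sub_completion; exact: tower_ground.
case: (reads_stuck A w z) => [[p zp]|[u [x [v [p [we zp np]]]]]].
  exists (completion (tower A (size w).+1 (isT : sorted (@stacks G) [::]))); split.
  - exact: completion_total.
  - exact: ground.
  - move=> zz; apply: nz.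
    have := reads_fun zz (reads_sub (f := fun c => (c, o)) (@ground _ _) zp).
    by case=> e; rewrite {2}e.
have /andP[ux rv] : uncancelled x v && reduced v.
  by move: rw; rewrite we; elim: (u) => [|a u' IH] //= /andP[_ /IH].
have sxs : sorted (@stacks G) (x :: chain x v) by exact: chain_stacks.
have szxs : size (x :: chain x v) < (size w).+1.
  rewrite ltnS we size_cat /=; apply: leq_trans (leq_addl _ _).
  exact: size_chain.
have lt1 : 1 < (size w).+1 by apply: leq_trans szxs.
set B := completion (tower A (size w).+1 sxs).
have totB : total_action B by exact: completion_total.
have ep : exposed A (x :: chain x v) p by move=> y [<-].
exists B; split=> //; first exact: ground.
have ch : drop 1 (x :: chain x v) = chain x v by rewrite /= drop0.
have [t pt t0] :=
  reads_above (o := Ordinal lt1) totB szxs erefl erefl ep ch.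
have zt : reads B w (z, o) t.
  rewrite {2}we; apply/reads_cat; exists (p, o).
    exact: reads_sub (@ground _ sxs) zp.
  exists (p, Ordinal lt1) => //; apply: sub_completion.
  by apply: Up; rewrite /= ?o0.
by move=> /(reads_fun zt) e; move: t0; rewrite e /= o0.
Qed.

(** * Corners and edges of cubes *)

Local Notation corner n := {ffun 'I_n -> bool}.

Definition flip n (p : corner n) (i : 'I_n) : corner n :=
  [ffun j => p j (+) (i == j)].

Lemma flipK n (i : 'I_n) : involutive (fun p : corner n => flip p i).
Proof. by move=> p; apply/ffunP => j; rewrite !ffunE addbK. Qed.

(** The corners of a cube are connected by its edges. *)
Lemma corner_ind n (P : corner n -> Prop) :
  P [ffun=> false] -> (forall p i, P p -> P (flip p i)) -> forall p, P p.
Proof.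
move=> P0 Pflip p.
suff key s : uniq s -> P [ffun j => (j \in s) && p j].
  have := key _ (enum_uniq 'I_n); congr P.
  by apply/ffunP => j; rewrite ffunE mem_enum.
elim: s => [|i s IH] /=; first by move=> _; congr P: P0; apply/ffunP => j; rewrite !ffunE.
case/andP=> i_s /IH {}IH; case pi: (p i).
  have := Pflip _ i IH; congr P; apply/ffunP => j; rewrite !ffunE inE eq_sym.
  by case: eqVneq => [->|_]; rewrite ?addbF // (negPf i_s) pi.
congr P: IH; apply/ffunP => j; rewrite !ffunE inE.
by case: eqVneq => [->|_] //=; rewrite (negPf i_s) pi.
Qed.

Lemma emb_corner_dir m n (f : cube_emb m n) (p : corner m) i :
  emb_corner f p (dir f i) = base f (dir f i) (+) p i.
Proof.
rewrite ffunE; congr (_ (+) _); apply/existsP/idP.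
  by case=> j /andP[/eqP/(injectiveP _ (dir_inj f)) ->].
by move=> pi; exists i; rewrite eqxx.
Qed.

Lemma emb_corner_out m n (f : cube_emb m n) (p : corner m) j :
  (forall i, dir f i != j) -> emb_corner f p j = base f j.
Proof.
move=> out; rewrite ffunE; case: existsP => [[i /andP[]]|_]; last by rewrite addbF.
by rewrite (negPf (out i)).
Qed.

Lemma emb_corner_ext m n (f : cube_emb m n) (p : corner m) (q : corner n) :
  (forall i, base f (dir f i) (+) p i = q (dir f i)) ->
  (forall j, (forall i, dir f i != j) -> base f j = q j) ->
  emb_corner f p = q.
Proof.
move=> din dout; apply/ffunP => j.
case: (pselect (exists i, dir f i = j)) => [[i <-]|no].
  by rewrite emb_corner_dir.
have out i : dir f i != j by apply/eqP => e; apply: no; exists i.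
by rewrite emb_corner_out ?dout.
Qed.

Lemma emb_corner_comp m n r (f : cube_emb n r) (g : cube_emb m n) p :
  emb_corner (emb_comp f g) p = emb_corner f (emb_corner g p).
Proof.
apply/esym/emb_corner_ext => [i|j out]; last first.
  rewrite emb_corner_out => [|i]; first by rewrite /= emb_corner_out.
  by rewrite ffunE.
rewrite [RHS]ffunE /= emb_corner_dir -addbA; congr (_ (+) _).
rewrite ffunE; congr (_ (+) _).
apply: eq_existsb => k; rewrite ffunE.
by rewrite (inj_eq (injectiveP _ (dir_inj f))).
Qed.

Lemma emb_corner_id n (p : corner n) : emb_corner (emb_id n) p = p.
Proof.
apply: emb_corner_ext => [i|j out]; first by rewrite !ffunE.
by have := out j; rewrite ffunE eqxx.
Qed.

Lemma emb_corner_flip m n (f : cube_emb m n) (p : corner m) i :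
  emb_corner f (flip p i) = flip (emb_corner f p) (dir f i).
Proof.
apply: emb_corner_ext => [j|j out].
  rewrite ffunE [RHS]ffunE emb_corner_dir -addbA.
  by rewrite (inj_eq (injectiveP _ (dir_inj f))).
by rewrite ffunE emb_corner_out // (negPf (out i)) addbF.
Qed.

Lemma corner_embE n (f : cube_emb 0 n) : f = corner_emb (base f).
Proof. by apply: cube_emb_inj => //; apply/ffunP => -[]. Qed.

Lemma corner0 (p : corner 0) : p = [ffun=> false].
Proof. by apply/ffunP => -[]. Qed.

Definition edge_emb n (p : corner n) (i : 'I_n) : cube_emb 1 n :=
  CubeEmb p (axis_dir_inj i).

Lemma edge_emb_source n (p : corner n) i :
  emb_corner (edge_emb p i) [ffun=> false] = p.
Proof.
apply/ffunP => j; rewrite ffunE; case: existsP => [[k]|]; last by rewrite addbF.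
by rewrite !ffunE andbF.
Qed.

Lemma edge_emb_target n (p : corner n) i :
  emb_corner (edge_emb p i) [ffun=> true] = flip p i.
Proof.
apply/ffunP => j; rewrite !ffunE; congr (_ (+) _); apply/existsP/idP.
  by case=> k; rewrite !ffunE => /andP[].
by move=> ij; exists ord0; rewrite !ffunE ij.
Qed.

Section Faces.
Variable X : cube_complex.

Definition vertex n (c : cube X n) (p : corner n) : cube X 0 :=
  restr (corner_emb p) c.
Definition edge n (c : cube X n) (p : corner n) (i : 'I_n) : cube X 1 :=
  restr (edge_emb p i) c.

Lemma vertex_restr m n (f : cube_emb m n) (c : cube X n) p :
  vertex (restr f c) p = vertex c (emb_corner f p).
Proof. by rewrite /vertex -restr_comp [emb_comp _ _]corner_embE. Qed.

Lemma vertex0 (x : cube X 0) p : vertex x p = x.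
Proof.
rewrite /vertex; have -> : corner_emb p = emb_id 0; last exact: restr_id.
by rewrite [emb_id 0]corner_embE (corner0 p).
Qed.

Lemma source_edge n (c : cube X n) p i : source (edge c p i) = vertex c p.
Proof. by rewrite /source /origin -/(vertex _ _) vertex_restr edge_emb_source. Qed.

Lemma target_edge n (c : cube X n) p i : target (edge c p i) = vertex c (flip p i).
Proof. by rewrite /target -/(vertex _ _) vertex_restr edge_emb_target. Qed.

End Faces.

(** * The partial action on the vertices of a local isometry *)

Section Salvetti.
Variable G : sgraph.
Local Notation S := (salvetti G).

Lemma salvetti0 (x y : cube S 0) : x = y.
Proof. by apply: val_inj; apply/ffunP => -[]. Qed.

Lemma edge_letter_inj : injective (@edge_letter G).
Proof.
move=> a b; rewrite /edge_letter => e; apply: val_inj.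
by apply/ffunP => i; rewrite [i]ord1.
Qed.

Lemma edge_letter_edge n (c : cube S n) (p : corner n) (i : 'I_n) :
  edge_letter (edge c p i) = ((val c i).1, (val c i).2 (+) p i).
Proof. by rewrite /edge_letter !ffunE. Qed.

Lemma edge_letter_axis n (c : cube S n) i : edge_letter (axis c i) = val c i.
Proof. by rewrite /edge_letter !ffunE /= addbF -surjective_pairing. Qed.

Lemma cube_adjl n (c : cube S n) i j : i != j -> adjl (val c i) (val c j).
Proof. by move: (valP c) => /forallP/(_ i)/forallP/(_ j)/implyP. Qed.

Lemma pair_clique (l k : letter G) : adjl l k ->
  clique_letters [ffun i : 'I_2 => if i == ord0 then l else k].
Proof.
move=> lk; apply/forallP => i; apply/forallP => j; apply/implyP; rewrite !ffunE.
case: (eqVneq i ord0) (eqVneq j ord0) => [->|i0] [_|j0] //=.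
- by rewrite -/(adjl k l) adjl_sym.
- by case: i j i0 j0 => [[|[|//]] i] [[|[|//]] j].
Qed.

Section IsometryAction.
Variables (Z : cube_complex) (phi : comb_map Z S).
Hypothesis phi_isom : local_isometry phi.

Definition edge_step (l : letter G) (s t : cube Z 0) : Prop :=
  exists2 a : cube Z 1, source a = s /\ target a = t & edge_letter (phi 1 a) = l.

Lemma edge_step_edge n (c : cube Z n) (p : corner n) (i : 'I_n) :
  edge_step ((val (phi n c) i).1, (val (phi n c) i).2 (+) p i)
    (vertex c p) (vertex c (flip p i)).
Proof.
exists (edge c p i); first by rewrite source_edge target_edge.
by rewrite /edge comb_restr -/(edge _ _ _) edge_letter_edge.
Qed.

Lemma edge_step_inv l s t : edge_step l s t -> edge_step (inv_letter l) t s.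
Proof.
case=> a [<- <-] <-; have := edge_step_edge a [ffun=> true] ord0.
rewrite ffunE addbT /target -/(vertex _ _); congr edge_step.
by rewrite /source /origin; congr vertex; apply/ffunP => i; rewrite [i]ord1 !ffunE.
Qed.

Lemma edge_step_fun l s t t' : edge_step l s t -> edge_step l s t' -> t = t'.
Proof.
case=> a [<- <-] al [b [ba <-] bl]; congr target.
by apply: phi_isom.1; [exact: esym | apply: edge_letter_inj; rewrite al bl].
Qed.

(** Two edges at a vertex with adjacent labels map to the two axes of a square of
    the Salvetti complex, which lifts by the definition of a local isometry. *)
Lemma edge_step_square l k : adjl l k -> square (edge_step l) (edge_step k).
Proof.
move=> lk s t u [a [a0 a1] al] [b [b0 b1] bl].
pose e (i : 'I_2) := if i == ord0 then a else b.
have e_inj : injective e.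
  have ab : a <> b.
    by move=> ab; have := adjl_neq lk; rewrite -al -bl ab eqxx.
  by case=> [[|[|//]] i] [[|[|//]] j] //= h; try (exact: val_inj); case: ab.
have e0 i : source (e i) = s by rewrite /e; case: ifP.
pose c : cube S 2 := exist (fun c => is_true (clique_letters c)) _ (pair_clique lk).
have ce i : axis c i = phi 1 (e i).
  apply: edge_letter_inj; rewrite edge_letter_axis ffunE /e.
  by case: ifP; rewrite ?al ?bl.
have [c' [oc ac pc]] := phi_isom.2 2 s e e_inj e0 c (salvetti0 _ _) ce.
have i01 : (ord_max : 'I_2) != ord0 by [].
have va i : target (e i) = vertex c' (flip [ffun=> false] i).
  by rewrite -ac -target_edge.
exists (vertex c' (flip (flip [ffun=> false] ord0) ord_max)).
  have := edge_step_edge c' (flip [ffun=> false] ord0) ord_max.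
  by rewrite pc /= !ffunE (negPf i01) /= addbF -surjective_pairing -va /e eqxx a1.
have := edge_step_edge c' (flip [ffun=> false] ord_max) ord0.
rewrite pc /= !ffunE (negPf i01) /= addbF -surjective_pairing -va /e (negPf i01) b1.
by congr edge_step; congr vertex; apply/ffunP => j; rewrite !ffunE addbAC.
Qed.

Definition isometry_action : paction G (cube Z 0) :=
  PAction edge_step_inv edge_step_fun edge_step_square.

Lemma reads_path w s t : reads isometry_action w s t ->
  exists2 q, is_path s q t & map (fun a => edge_letter (phi 1 a)) q = w.
Proof.
elim: w s => [|l w IH] s /=; first by exists [::].
by case=> r [a [as_ ar] <-] /IH[q rq <-]; exists (a :: q) => //=; rewrite ar.
Qed.

End IsometryAction.

(** * The covering of a total action *)

Section Covering.
Variables (X : Type) (A : paction G X).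

(** The lifts to the covering of a cube [c] of the Salvetti complex are given by
    their corners, joined by edges of the action as [c] prescribes.  Recording
    all corners, rather than a single one, makes the restriction to a face a mere
    composition. *)
Definition sheet n (c : cube S n) (h : {ffun corner n -> X}) : Prop :=
  forall (p : corner n) i, A ((val c i).1, (val c i).2 (+) p i) (h p) (h (flip p i)).

Definition cover_cube n : Type :=
  {hc : {ffun corner n -> X} * cube S n | sheet hc.2 hc.1}.

Lemma cover_cube_eq n (y y' : cover_cube n) :
  (sval y).1 = (sval y').1 -> (sval y).2 = (sval y').2 -> y = y'.
Proof.
case: y y' => [[h c] i] [[h' c'] i'] /= e e'; subst.
by congr exist; exact: Prop_irrelevance.
Qed.

Lemma cover_restr_subproof m n (f : cube_emb m n) (y : cover_cube n) :
  sheet (restr f (sval y).2) [ffun p => (sval y).1 (emb_corner f p)].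
Proof.
move=> p i; rewrite !ffunE emb_corner_flip.
by have := svalP y (emb_corner f p) (dir f i); rewrite emb_corner_dir /= !addbA.
Qed.

Definition cover_restr m n (f : cube_emb m n) (y : cover_cube n) : cover_cube m :=
  exist (fun hc => sheet hc.2 hc.1) (_, _) (cover_restr_subproof f y).

Lemma cover_restr_id n (y : cover_cube n) : cover_restr (emb_id n) y = y.
Proof.
apply: cover_cube_eq; last exact: restr_id.
by apply/ffunP => p; rewrite ffunE emb_corner_id.
Qed.

Lemma cover_restr_comp m n r (f : cube_emb n r) (g : cube_emb m n) (y : cover_cube r) :
  cover_restr (emb_comp f g) y = cover_restr g (cover_restr f y).
Proof.
apply: cover_cube_eq; last exact: restr_comp.
by apply/ffunP => p; rewrite !ffunE emb_corner_comp.
Qed.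

Lemma cover_restr_free n (s : cube_emb n n) (y : cover_cube n) :
  cover_restr s y = y -> s = emb_id n.
Proof. by move=> /(congr1 (fun y => (sval y).2)) /restr_free. Qed.

Definition cover : cube_complex :=
  CubeComplex cover_restr_id cover_restr_comp cover_restr_free.

Definition cover_map : comb_map cover S :=
  @CombMap cover S (fun n y => (sval y).2) (fun m n f y => erefl).

Definition cover_pt (y : cube cover 0) : X := (sval y).1 [ffun=> false].

Lemma cover_pt_vertex n (y : cube cover n) p : cover_pt (vertex y p) = (sval y).1 p.
Proof. by rewrite /cover_pt ffunE /=; congr (_ _); apply: emb_corner_ext => [[]|]. Qed.

Hypothesis totA : total_action A.

Lemma sheet_uniq n (c : cube S n) h h' : sheet c h -> sheet c h' ->
  h [ffun=> false] = h' [ffun=> false] -> h = h'.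
Proof.
move=> hc hc' h0; apply/ffunP; apply: corner_ind => // p i e.
by have := hc' p i; rewrite -e; exact: step_fun.
Qed.

(** The corner [p] is reached from [x] by the letters of [c] along the axes on
    which [p] is true; the order does not matter because they commute. *)
Lemma sheet_exists n (c : cube S n) x : exists2 h, sheet c h & h [ffun=> false] = x.
Proof.
have [act actP] : {act : letter G * X -> X & forall lx, A lx.1 lx.2 (act lx)}.
  exact: choice (fun lx => totA lx.1 lx.2).
pose walk s (p : corner n) := foldr (fun i y => if p i then act (val c i, y) else y) x s.
have act_comm l k y : adjl l k -> act (l, act (k, y)) = act (k, act (l, y)).
  move=> lk; have [r h1 h2] := step_square lk (actP (l, y)) (actP (k, y)).
  by rewrite (step_fun (actP (k, act (l, y))) h1) (step_fun (actP (l, act (k, y))) h2).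
have walk_out s (p : corner n) i : i \notin s -> walk s (flip p i) = walk s p.
  elim: s => [//|j s IH]; rewrite inE negb_or => /andP[ij /IH /= ->].
  by rewrite ffunE (negPf ij) addbF.
have walk_flip s (p : corner n) i : uniq s -> i \in s -> ~~ p i ->
    walk s (flip p i) = act (val c i, walk s p).
  elim: s => [//|j s IH] /= /andP[js us]; rewrite inE ffunE.
  case: eqVneq => [e _ pi|ij /= si pi].
    by rewrite -e in js *; rewrite (negPf pi) /= walk_out.
  rewrite addbF IH //; case: ifP => // _.
  by apply: act_comm; apply: cube_adjl; rewrite eq_sym.
exists [ffun p => walk (enum 'I_n) p]; last first.
  by rewrite ffunE /walk; elim: (enum _) => //= i s ->; rewrite ffunE.
have up (p : corner n) i : ~~ p i ->
    A (val c i) (walk (enum 'I_n) p) (walk (enum 'I_n) (flip p i)).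
  by move=> pi; rewrite walk_flip ?enum_uniq ?mem_enum //; exact: (actP (_, _)).
move=> p i; rewrite !ffunE; case pi: (p i); last first.
  by rewrite addbF -surjective_pairing; apply: up; rewrite pi.
rewrite addbT; apply: (@step_inv _ _ A (val c i)).
by have := up (flip p i) i; rewrite flipK ffunE pi eqxx; exact.
Qed.

Lemma cover_exists n (c : cube S n) x :
  exists2 y : cube cover n, cover_map n y = c & cover_pt (origin y) = x.
Proof.
have [h hc h0] := sheet_exists c x.
by exists (exist (fun hc => sheet hc.2 hc.1) (h, c) hc); rewrite // cover_pt_vertex.
Qed.

Lemma cover_pt_inj : injective cover_pt.
Proof.
move=> y y' e; apply: cover_cube_eq; last exact: salvetti0.
by apply/ffunP => p; rewrite (corner0 p).
Qed.

Lemma cover_locally_injective : locally_injective cover_map.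
Proof.
move=> n y y' /(congr1 cover_pt); rewrite !cover_pt_vertex => e0 e.
apply: cover_cube_eq => //; apply: sheet_uniq (svalP y) _ e0.
have := svalP y'; rewrite -[(sval y').2]e; exact.
Qed.

Lemma cover_isometry : local_isometry cover_map.
Proof.
split=> [|n y e _ e0 c _ ce]; first exact: cover_locally_injective.
have [y' yc y0] := cover_exists c (cover_pt y).
have oy : origin y' = y by exact: cover_pt_inj.
exists y'; split=> // i; apply: cover_locally_injective.
  rewrite [RHS](e0 i) -oy; exact: (source_edge y' [ffun=> false] i).
by rewrite -ce -yc /axis comb_restr.
Qed.

Lemma cover_step (a : cube cover 1) :
  A (edge_letter (cover_map 1 a)) (cover_pt (source a)) (cover_pt (target a)).
Proof.
rewrite !cover_pt_vertex; have := svalP a [ffun=> false] ord0.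
rewrite ffunE addbF -surjective_pairing; congr (A _ _ ((sval a).1 _)).
by apply/ffunP => i; rewrite [i]ord1 !ffunE.
Qed.

Lemma cover_lift (p : seq (cube S 1)) (y : cube cover 0) :
  exists q y', [/\ is_path y q y', map (cover_map 1) q = p
                 & reads A (map (@edge_letter G) p) (cover_pt y) (cover_pt y')].
Proof.
elim: p y => [|a p IH] y; first by exists [::], y.
have [b ba b0] := cover_exists a (cover_pt y).
have [q [y' [bq qp r]]] := IH (target b).
exists (b :: q), y'; split=> /=; [split=> //; exact: cover_pt_inj | by congr cons |].
by exists (cover_pt (target b)) => //; rewrite -ba -b0; exact: cover_step.
Qed.

Lemma card_cover0 : ([set: cube cover 0] #<= [set: X])%card.
Proof.
have [mk mkP] : {mk : X -> cube cover 0 & forall x, cover_pt (mk x) = x}.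
  apply: (@choice _ _ (fun x y => cover_pt y = x)) => x.
  by have [y _ yx] := cover_exists (salvetti_base G) x; exists (origin y).
apply: card_le_trans (card_image_le mk setT); apply: subset_card_le => y _.
by exists (cover_pt y) => //; apply: cover_pt_inj; exact: mkP.
Qed.

Section Lift.
Variables (Z : cube_complex) (phi : comb_map Z S) (f : cube Z 0 -> X).
Hypothesis fP : forall l s t, edge_step phi l s t -> A l (f s) (f t).

Lemma lift_subproof n (c : cube Z n) : sheet (phi n c) [ffun p => f (vertex c p)].
Proof. by move=> p i; rewrite !ffunE; apply: fP; exact: edge_step_edge. Qed.

Definition lift_fun n (c : cube Z n) : cube cover n :=
  exist (fun hc => sheet hc.2 hc.1) (_, _) (lift_subproof c).

Lemma lift_restr m n (e : cube_emb m n) (c : cube Z n) :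
  lift_fun (restr e c) = restr e (lift_fun c).
Proof.
apply: cover_cube_eq; last exact: comb_restr.
by apply/ffunP => p; rewrite !ffunE vertex_restr.
Qed.

Definition lift_map : comb_map Z cover := CombMap lift_restr.

Lemma cover_pt_lift z : cover_pt (lift_map 0 z) = f z.
Proof. by rewrite /cover_pt ffunE vertex0. Qed.

(** A cube is determined by its origin and its image under [phi]. *)
Lemma lift_embedding : locally_injective phi -> injective f -> embedding lift_map.
Proof.
move=> phi_inj f_inj n c c' e; apply: phi_inj.
  apply: f_inj; have := congr1 (fun y : cube cover n => (sval y).1 [ffun=> false]) e.
  by rewrite !ffunE.
exact: (congr1 (fun y : cube cover n => (sval y).2) e).
Qed.

End Lift.
End Covering.
End Salvetti.

(** * The separating cover *)

Lemma finite_vertices (Z : cube_complex) : cc_compact Z -> finite_set [set: cube Z 0].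
Proof.
move=> /(finite_image (fun c : {n & cube Z n} => origin (tagged c))).
by apply: sub_finite_set => x _; exists (Tagged (cube Z) x) => //; exact: vertex0.
Qed.

Theorem theorem1 (G : sgraph) (Z : cube_complex) (z : cube Z 0)
    (phi : comb_map Z (salvetti G))
    (Zcompact : cc_compact Z) (Zconnected : cc_connected Z)
    (phi_based : phi 0 z = salvetti_base G)
    (phi_isom : local_isometry phi)
    (g : raag G) (gZ : ~ pi1_image phi z g) :
  exists (Y : cube_complex) (y : cube Y 0)
         (iota : comb_map Z Y) (psi : comb_map Y (salvetti G)),
    (embedding iota /\ iota 0 z = y)
    /\ (local_isometry psi /\ psi 0 y = salvetti_base G /\
        (forall n (c : cube Z n), psi n (iota n c) = phi n c))
    /\ (forall p : seq (cube (salvetti G) 1),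
          is_path (salvetti_base G) p (salvetti_base G) -> path_val p = g ->
          exists (q : seq (cube Y 1)) (y' : cube Y 0),
            is_path y q y' /\ map (psi 1) q = p /\ y' <> y)
    /\ ([set: cube Y 0] #<=
         [set: cube Z 0 * 'I_(word_length g).+1])%classic%card.
Proof.
have [w [wg szw rw]] := word_length_geodesic g.
have nz : ~ reads (isometry_action phi_isom) w z z.
  move=> /reads_path[q zq qw]; apply: gZ; exists q => //.
  by rewrite /path_val -map_comp -wg -qw.
have [B [totB ZB Bz]] :=
  separating_action (o := ord0) (finite_vertices Zcompact) erefl rw nz.
exists (cover B), (lift_map (f := fun c => (c, ord0)) ZB 0 z).
exists (lift_map ZB), (cover_map B).
split; first by split=> //; apply: lift_embedding phi_isom.1 _ => c d [].
split; first by split; [exact: (cover_isometry totB) | split=> //; exact: salvetti0].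
split; last by rewrite -szw; exact: (card_cover0 totB).
move=> p _ pg; have [q [y' [yq qp r]]] := cover_lift totB p (lift_map ZB 0 z).
exists q, y'; do 2!split=> //; move=> e; apply: Bz.
have pw : raag_cong (map (@edge_letter G) p) w.
  by apply/raag_eqP; rewrite -!word_valE wg.
by move: r; rewrite e cover_pt_lift; apply: (reads_cong totB pw _ _).1.
Qed.
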